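(* For every nonnegative integer $m$, $$\sum_{\mathcal D}w^e_{\mathcal D}(q)=\hat E_{2m}(q)\qquad\text{and}\qquad\sum_{\mathcal D}w^o_{\mathcal D}(q)=\hat E_{2m+1}(q),$$ where both sums are over all Dyck paths $\mathcal D$ of length $2m$.
   Context: A Dyck path of length $2m$ is a lattice path from $(0,0)$ to $(2m,0)$ with steps from $(x,y)$ to $(x+1,y+1)$ (up-steps) or $(x+1,y-1)$ (down-steps) never going below the $x$-axis. The level $\ell(i)$ of the $i$-th step is the $y$-coordinate of the highest point of that step. With $[k]_q=1+q+\cdots+q^{k-1}$, set $w^e_{\mathcal D,i}(q)=[\ell(i)]_q$, and $w^o_{\mathcal D,i}(q)=[\ell(i)]_q$ if step $i$ is an up-step and $[\ell(i)+1]_q$ if it is a down-step; $w^e_{\mathcal D}(q)=\prod_{i=1}^{2m}w^e_{\mathcal D,i}(q)$ and $w^o_{\mathcal D}(q)=\prod_{i=1}^{2m}w^o_{\mathcal D,i}(q)$. For $\sigma\in\mathfrak S_n$, $\hat\imath(\sigma)=\sum_{i=1}^{n-1}\hat c_i(\sigma)$, where $\hat c_i(\sigma)$ is the number of $j>i$ with $\sigma_i>\sigma_j$ if $i$ is odd and with $\sigma_i<\sigma_j$ if $i$ is even. $\mathrm{Alt}_n$ is the set of down-up permutations $\sigma_1>\sigma_2<\sigma_3>\cdots$ of $[n]$, and $\hat E_n(q)=q^{-\lfloor n^2/4\rfloor}\sum_{\sigma\in\mathrm{Alt}_n}q^{\hat\imath(\sigma)}$. *)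

(* Defs.v *)
From HB Require Import structures.
From mathcomp Require Import all_boot all_order all_algebra perm.

Set Implicit Arguments.
Unset Strict Implicit.
Unset Printing Implicit Defensive.

Import Order.TTheory GRing.Theory Num.Theory.
Local Open Scope ring_scope.

(* q is an indeterminate: path weights live in Z[q] = {poly int}, with q = 'X,
   and the negative power of q in Ehat is taken in the fraction field. *)

Definition qint (k : nat) : {poly int} := \sum_(i < k) 'X^i.

(* A path is its sequence of steps: true is an up-step, false a down-step. *)
Definition step_height (up : bool) : int := if up then 1 else -1.

(* y-coordinate after the first k steps *)
Definition height (s : seq bool) (k : nat) : int :=
  \sum_(up <- take k s) step_height up.

Definition dyck (s : seq bool) : bool :=
  all (fun k => 0 <= height s k) (iota 0 (size s).+1)
  && (height s (size s) == 0).

(* Steps are numbered from 0, so step i joins the points of abscissa i and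
   i + 1. On a Dyck path the maximum is nonnegative, and the absolute value
   is only a conversion to nat. *)
Definition level (s : seq bool) (i : nat) : nat :=
  `|Num.max (height s i) (height s i.+1)|%N.

Definition weight_even (s : seq bool) : {poly int} :=
  \prod_(i < size s) qint (level s i).

Definition weight_odd (s : seq bool) : {poly int} :=
  \prod_(i < size s)
    qint (if nth false s i then level s i else (level s i).+1).

(* Positions and values of a permutation are numbered from 0, so the odd
   positions of the usual one-line notation are the even indices here. *)
Definition alt_code n (s : 'S_n) (i : 'I_n) : nat :=
  #|[set j : 'I_n | (i < j)%N &
      (if odd i then (s i < s j)%N else (s j < s i)%N)]|.

Definition alt_inv n (s : 'S_n) : nat :=
  (\sum_(i < n | (i.+1 < n)%N) alt_code s i)%N.

(* down-up permutations *)
Definition Alt_perms n : {set 'S_n} :=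
  [set s : 'S_n | [forall i : 'I_n, forall j : 'I_n,
     (j == i.+1 :> nat) ==>
     (if odd i then (s i < s j)%N else (s j < s i)%N)]].

Definition Ehat (n : nat) : {fraction {poly int}} :=
  tofrac 'X ^- (n ^ 2 %/ 4) * \sum_(s in Alt_perms n) tofrac 'X ^+ alt_inv s.

(* Main.v *)
(* For i = 2k - 1, 2k and j > 2k, the down-up condition makes the pairs (i, j)
   contribute 1 + [sigma_2k < sigma_j < sigma_(2k-1)] to the statistic, so that
   Ehat_n(q) enumerates down-up permutations by occurrences of the pattern
   31-2. Scanning the values in increasing order, this is a count of weighted
   paths whose height is the number of blocks already formed; refined by the
   value of sigma_1, it becomes a pairing of a path segment read before that
   value with one read after it. The identity is proved algebraically: these
   pairings satisfy the q-Entringer recurrence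
     Phi(r+1, s) = q Phi(r, s+1) + q^(r+1) Phi(s, r),
   where r and s are the numbers of values below and above sigma_1. The first
   term comes from [t+1] - q [t] = 1; the second from transposing the transfer
   matrices, which exchanges the even and the odd weights. On the side of
   permutations, the same recurrence is obtained by deleting sigma_1 and
   complementing the values. *)
Require Import Defs.
From HB Require Import structures.
From mathcomp Require Import all_boot all_order all_algebra perm.
From mathcomp Require Import zify ring.

Set Implicit Arguments.
Unset Strict Implicit.
Unset Printing Implicit Defensive.

Import Order.TTheory GRing.Theory Num.Theory.
Local Open Scope ring_scope.

(** * q-integers and weighted path sums *)

Lemma qint0 : qint 0 = 0.
Proof. by rewrite /qint big_ord0. Qed.

Lemma qintS k : qint k.+1 = 1 + 'X * qint k.
Proof.
rewrite /qint big_ord_recl expr0 mulr_sumr.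
by congr (_ + _); apply: eq_bigr => i _; rewrite exprS.
Qed.

Lemma qint1 : qint 1 = 1.
Proof. by rewrite qintS qint0 mulr0 addr0. Qed.

(** Paths of [n] steps from height [t] to 0 with the even weights. At [t = 0] the truncated [t.-1]
    is harmless because [qint 0 = 0]. *)
Fixpoint sec_paths (n t : nat) : {poly int} :=
  if n is n'.+1 then
    qint t.+1 * sec_paths n' t.+1 + qint t * sec_paths n' t.-1
  else (t == 0%N)%:R.

(* The height is shifted by one with respect to [weight_odd], so that a last
   step, of weight 1, leads to the absorbing height 0. *)
Fixpoint tan_paths (n t : nat) : {poly int} :=
  if n is n'.+1 then qint t * (tan_paths n' t.+1 + tan_paths n' t.-1)
  else (t == 0%N)%:R.

Lemma sec_paths_eq0 n t : (n < t)%N -> sec_paths n t = 0.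
Proof.
elim: n t => [|n IHn] t /= lt_nt; first by case: t lt_nt.
by rewrite !IHn ?mulr0 ?addr0 //; lia.
Qed.

Lemma tan_paths_eq0 n t : (n < t)%N -> tan_paths n t = 0.
Proof.
elim: n t => [|n IHn] t /= lt_nt; first by case: t lt_nt.
by rewrite !IHn ?addr0 ?mulr0 //; lia.
Qed.

Lemma tan_pathsS0 n : tan_paths n.+1 0 = 0.
Proof. by rewrite /= qint0 mul0r. Qed.

(** * Recurrences for the pairings of path segments *)

Section Pairings.

Variable N : nat.

(* Gluing of a path from 0 to t (counted backwards, whence the power of q) and
   of a path from t to 0. *)
Definition odd_pairing (r s : nat) : {poly int} :=
  \sum_(t < N) 'X^((r - t)./2) * sec_paths r t * tan_paths s t.

Definition even_pairing (r s : nat) : {poly int} :=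
  \sum_(t < N) 'X^((r.-1 - t)./2) * tan_paths r t.+1 * sec_paths s t.

Lemma sum_shift (x : nat -> {poly int}) :
  x 0 = 0 -> x N = 0 -> \sum_(t < N) x t.+1 = \sum_(t < N) x t.
Proof.
move=> x0 xN; transitivity (\sum_(t < N.+1) x t).
  by rewrite big_ord_recl x0 add0r.
by rewrite big_ord_recr /= xN addr0.
Qed.

(** Expand the first step of [sec_paths r.+1] on the left and of [tan_paths s.+1] on the right. The
    terms in [tan_paths s t.-1] agree; those in [tan_paths s t.+1] differ by the factor [t+1] - q
    [t] = 1. *)
Lemma odd_pairingS r s : (r.+1 < N)%N ->
  odd_pairing r.+1 s = 'X * odd_pairing r s.+1
    + \sum_(t < N) 'X^((r - t)./2) * sec_paths r t * tan_paths s t.+1.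
Proof.
move=> lt_rN.
(* [x] comes from the opening up-steps and [y] from the opening down-steps, both to be summed over
   the height reached. The boundary terms vanish by [qint 0] and because height [N] is out of
   reach. *)
pose x t := 'X^((r.+2 - t)./2) * (qint t * sec_paths r t) * tan_paths s t.-1.
pose y t := 'X^((r.+1 - t)./2) * (qint t * sec_paths r t.-1) * tan_paths s t.
have -> : odd_pairing r.+1 s = \sum_(t < N) x t + \sum_(t < N) y t.+1.
  rewrite -(sum_shift (x := x)) ?(sum_shift (x := y)).
  - rewrite -big_split; apply: eq_bigr => t _.
    by rewrite /x /y /= subSS mulrDr mulrDl.
  - by rewrite /y qint0 mul0r mulr0 mul0r.
  - by rewrite /y sec_paths_eq0 ?mulr0 ?mul0r //; lia.
  - by rewrite /x qint0 mul0r mulr0 mul0r.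
  - by rewrite /x sec_paths_eq0 ?mulr0 ?mul0r //; lia.
rewrite mulr_sumr -!big_split; apply: eq_bigr => t _ /=.
rewrite /x /y /= subSS qintS.
have [le_tr | lt_rt] := leqP t r; last first.
  by rewrite sec_paths_eq0 // !(mulr0, mul0r, addr0).
have -> : ((r.+2 - t)./2 = (r - t)./2.+1)%N by lia.
by rewrite exprS; ring.
Qed.

(** The same cancellation with the roles exchanged: [t+1] comes from a step of the [tan_paths]
    segment and q [t] from an up-step of the [sec_paths] segment. *)
Lemma even_pairingS r s : (r.+1 < N)%N ->
  even_pairing r.+1 s = 'X * even_pairing r s.+1
    + \sum_(t < N) 'X^((r - t)./2) * tan_paths r t * sec_paths s t.
Proof.
move=> lt_rN.
pose x t := 'X^((r.+1 - t)./2) * (qint t * tan_paths r t.+1)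
  * sec_paths s t.-1.
pose z t := 'X^((r.+1 - t)./2) * tan_paths r t * (qint t * sec_paths s t).
have E : even_pairing r.+1 s = \sum_(t < N) x t
    + \sum_(t < N) 'X^((r - t)./2) * (qint t.+1 * tan_paths r t) * sec_paths s t.
  rewrite -(sum_shift (x := x)).
  - rewrite -big_split; apply: eq_bigr => t _.
    by rewrite /x /= subSS; ring.
  - by rewrite /x qint0 mul0r mulr0 mul0r.
  - by rewrite /x tan_paths_eq0 ?mulr0 ?mul0r //; lia.
have E' : 'X * even_pairing r s.+1 = \sum_(t < N) x t
    + \sum_(t < N) 'X^((r - t)./2.+1) * tan_paths r t * (qint t * sec_paths s t).
  pose w t := 'X^((r - t)./2.+1) * tan_paths r t * (qint t * sec_paths s t).
  rewrite -(sum_shift (x := w)).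
  - rewrite mulr_sumr -big_split; apply: eq_bigr => t _ /=.
    rewrite /x /w /=.
    have [le_tr | lt_rt] := leqP t.+1 r; last first.
      by rewrite tan_paths_eq0 // !(mulr0, mul0r, addr0).
    have -> : ((r - t.+1)./2.+1 = (r.-1 - t)./2.+1)%N by lia.
    have -> : ((r.+1 - t)./2 = (r.-1 - t)./2.+1)%N by lia.
    by rewrite exprS; ring.
  - by rewrite /w qint0 mul0r mulr0.
  - by rewrite /w tan_paths_eq0 ?mulr0 ?mul0r //; lia.
rewrite E E' -addrA; congr (_ + _); rewrite -big_split; apply: eq_bigr => t _.
by rewrite /= qintS exprS; ring.
Qed.

(** Both sums contain the same products of path sums. As r and s - 1 have the same parity, the two
    halved exponents differ by an amount free of t. *)
Lemma odd_pairing_swap r s : odd (r + s) ->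
  'X^((r + s).+2./2)
      * (\sum_(t < N) 'X^((r - t)./2) * sec_paths r t * tan_paths s t.+1)
  = 'X^(r.+1) * even_pairing s r.
Proof.
move=> odd_rs; rewrite !mulr_sumr; apply: eq_bigr => t _.
have [le_tr | lt_rt] := leqP t r; last first.
  by rewrite sec_paths_eq0 // !(mulr0, mul0r).
have [lt_ts | le_st] := ltnP t s; last first.
  by rewrite tan_paths_eq0 // !(mulr0, mul0r).
have E : ((r + s).+2./2 + (r - t)./2 = r.+1 + (s.-1 - t)./2)%N by lia.
by rewrite !mulrA -!exprD E; ring.
Qed.

Lemma even_pairing_swap r s : ~~ odd (r + s) ->
  'X^((r + s).+2./2)
      * (\sum_(t < N) 'X^((r - t)./2) * tan_paths r t * sec_paths s t)
  = 'X^(r.+1) * odd_pairing s r.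
Proof.
move=> even_rs; rewrite !mulr_sumr; apply: eq_bigr => t _.
have [le_tr | lt_rt] := leqP t r; last first.
  by rewrite tan_paths_eq0 // !(mulr0, mul0r).
have [le_ts | lt_st] := leqP t s; last first.
  by rewrite sec_paths_eq0 // !(mulr0, mul0r).
have E : ((r + s).+2./2 + (r - t)./2 = r.+1 + (s - t)./2)%N by lia.
by rewrite !mulrA -!exprD E; ring.
Qed.

End Pairings.

Lemma sqr_div4S n : (n.+1 ^ 2 %/ 4 = n ^ 2 %/ 4 + n.+1./2)%N.
Proof.
rewrite -(odd_double_half n); case: (odd n); move: n./2 => k.
  have -> : ((1 + k.*2).+1 ^ 2 = k.+1 ^ 2 * 4)%N by rewrite -mul2n; ring.
  have -> : ((1 + k.*2) ^ 2 = (k ^ 2 + k) * 4 + 1)%N by rewrite -mul2n; ring.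
  rewrite mulnK // divnMDl //; lia.
have -> : ((0 + k.*2) ^ 2 = k ^ 2 * 4)%N by rewrite -mul2n; ring.
have -> : ((0 + k.*2).+1 ^ 2 = (k ^ 2 + k) * 4 + 1)%N by rewrite -mul2n; ring.
by rewrite mulnK // divnMDl //; lia.
Qed.

(** * Down-up permutations and the q-Entringer recurrence *)

(** The flag [b], here and in [inv_from], shifts the parity of positions, as deleting the first
    entry does; [true] gives up-down permutations. *)
Definition zigzag_from b n (s : 'S_n) : bool :=
  [forall i : 'I_n, forall j : 'I_n, (j == i.+1 :> nat) ==>
     (if odd i (+) b then (s i < s j)%N else (s j < s i)%N)].

Definition inv_from b n (s : 'S_n) : nat :=
  (\sum_(i < n) \sum_(j < n)
     ((i < j) && (if odd i (+) b then s i < s j else s j < s i)))%N.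

Lemma alt_invE n (s : 'S_n) : alt_inv s = inv_from false s.
Proof.
rewrite /alt_inv /inv_from big_mkcond; apply: eq_bigr => i _.
have -> : alt_code s i = (\sum_(j < n)
     ((i < j) && (if odd i (+) false then s i < s j else s j < s i)))%N.
  rewrite /alt_code addbF -sum1dep_card big_mkcond.
  by apply: eq_bigr => j _; case: (_ && _).
case: ltnP => // le_ni; rewrite big1 // => j _.
by have := ltn_ord j; case: ltnP => //; lia.
Qed.

Lemma card_ltn_ord n (j : 'I_n) : #|[set k : 'I_n | (k < j)%N]| = j.
Proof.
rewrite -sum1dep_card -(big_mkord (fun k => k < j)%N (fun _ => 1%N)).
rewrite -(big_nat_widen 0 _ _ predT) 1?ltnW //.
by rewrite sum_nat_const_nat subn0 muln1.
Qed.

Lemma ltn_lift n (j : 'I_n.+1) (x y : 'I_n) :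
  (lift j x < lift j y)%N = (x < y)%N.
Proof. by rewrite /= !ltnNge leq_bump2. Qed.

Lemma inv_from_lift n (j : 'I_n.+1) (s : 'S_n) :
  inv_from false (lift_perm ord0 j s) = (j + inv_from true s)%N.
Proof.
rewrite /inv_from big_ord_recl; congr (_ + _)%N.
  (* The first entry exceeds exactly the [j] smaller values; the preimage turns this count of values
     into one of positions. *)
  rewrite -[RHS]card_ltn_ord -(card_preimset _ (@perm_inj _ (lift_perm ord0 j s))).
  rewrite -sum1_card [RHS]big_mkcond; apply: eq_bigr => k _.
  rewrite !inE /= lift_perm_id; case: (unliftP ord0 k) => [k'|] -> /=.
    by case: ltnP.
  by rewrite lift_perm_id ltnn.
apply: eq_bigr => i _; rewrite big_ord_recl ltn0 add0n.
apply: eq_bigr => k _; rewrite !lift_perm_lift !ltn_lift.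
by rewrite [lift ord0 i : nat]lift0 /= addbF addbT.
Qed.

(** The condition on the first entry of [s] is quantified because ['I_n] may be empty. *)
Lemma zigzag_from_lift n (j : 'I_n.+1) (s : 'S_n) :
  zigzag_from false (lift_perm ord0 j s)
  = zigzag_from true s && [forall i : 'I_n, (i == 0 :> nat) ==> (s i < j)%N].
Proof.
apply/idP/andP => [/forallP zz | [/forallP zz /forallP s0]].
  split; apply/forallP=> i.
    apply/forallP=> k; apply/implyP=> /eqP ki.
    have /forallP/(_ (lift ord0 k))/implyP := zz (lift ord0 i).
    rewrite !lift_perm_lift !ltn_lift [lift ord0 i : nat]lift0 /= addbF addbT.
    by apply; rewrite /bump ki.
  apply/implyP=> /eqP i0.
  have /forallP/(_ (lift ord0 i))/implyP := zz ord0.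
  rewrite lift_perm_lift lift_perm_id [lift ord0 i : nat]lift0 i0 => /(_ isT) /=.
  by rewrite /bump; case: leqP => //; lia.
apply/forallP=> i; apply/forallP=> k; apply/implyP.
case: (unliftP ord0 k) => [k'|] -> //; rewrite lift0 => /eqP[].
case: (unliftP ord0 i) => [i'|] -> ki.
  have /forallP/(_ k')/implyP := zz i'; rewrite !lift_perm_lift !ltn_lift.
  rewrite [lift ord0 i' : nat]lift0 /= addbF addbT; apply.
  by rewrite ki lift0.
have /implyP/(_ (introT eqP ki)) := s0 k'.
rewrite lift_perm_lift lift_perm_id /=.
by rewrite /bump; case: leqP => //; lia.
Qed.

(** Leads back from up-down to down-up permutations once the first entry is deleted. *)
Definition complement n (s : 'S_n) : 'S_n := (s * perm (@rev_ord_inj n))%g.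

Lemma complementE n (s : 'S_n) i : complement s i = rev_ord (s i).
Proof. by rewrite permM permE. Qed.

Lemma complementK n : involutive (@complement n).
Proof. by move=> s; apply/permP=> i; rewrite !complementE rev_ordK. Qed.

Lemma ltn_complement n (s : 'S_n) i j :
  (complement s i < complement s j)%N = (s j < s i)%N.
Proof.
rewrite !complementE /=.
by have := ltn_ord (s i); have := ltn_ord (s j); lia.
Qed.

Lemma zigzag_complement n (s : 'S_n) :
  zigzag_from true (complement s) = zigzag_from false s.
Proof.
apply: eq_forallb => i; apply: eq_forallb => j; rewrite !ltn_complement.
by rewrite addbT addbF; case: (odd i).
Qed.

Lemma inv_complement n (s : 'S_n) :
  inv_from true (complement s) = inv_from false s.
Proof.
apply: eq_bigr => i _; apply: eq_bigr => j _; rewrite !ltn_complement.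
by rewrite addbT addbF; case: (odd i).
Qed.

(* In the notation Phi of the header, [entringer (r + s) r] is Phi(r, s). *)
Definition entringer n (r : nat) : {poly int} :=
  \sum_(s : 'S_n.+1 | zigzag_from false s && (s ord0 == r :> nat))
    'X^(inv_from false s).

(** Deleting the first entry [j] yields the factor q^j; complementing then turns the next entry v
    into n - 1 - v, whence the form of the bound. *)
Lemma entringer_lift n (j : 'I_n.+1) : entringer n j =
  'X^j * \sum_(s : 'S_n | zigzag_from false s
            && [forall i : 'I_n, (i == 0 :> nat) ==> (n - (s i).+1 < j)%N])
           'X^(inv_from false s).
Proof.
rewrite /entringer (reindex (lift_perm ord0 j)); last first.
  (* [ulsf i s] is [s] with position [i] and its value removed: the inverse of [lift_perm]. The
     default [k] is never reached. *)
  pose ulsf i (s : 'S_n.+1) k := odflt k (unlift (s i) (s (lift i k))).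
  have ulsfK i (s : 'S_n.+1) k: lift (s i) (ulsf i s k) = s (lift i k).
    rewrite /ulsf; have:= neq_lift i k.
    by rewrite -(can_eq (permK s)) => /unlift_some[] ? ? ->.
  have inj_ulsf: injective (ulsf ord0 _).
    move=> s; apply: can_inj (ulsf (s ord0) s^-1%g) _ => k'.
    by rewrite {1}/ulsf ulsfK !permK liftK.
  exists (fun s => perm (inj_ulsf s)) => [s _ | s].
    by apply/permP=> k'; rewrite permE /ulsf lift_perm_lift lift_perm_id liftK.
  rewrite inE => /andP[_ /eqP/val_inj si0]; apply/permP=> k.
  case: (unliftP ord0 k) => [k'|] ->; rewrite ?lift_perm_id //.
  by rewrite lift_perm_lift -si0 permE ulsfK.
rewrite (reindex_inj (can_inj (@complementK n))) mulr_sumr.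
apply: eq_big => s.
  rewrite zigzag_from_lift lift_perm_id eqxx andbT zigzag_complement.
  by congr (_ && _); apply: eq_forallb => i; rewrite complementE.
by rewrite inv_from_lift inv_complement exprD.
Qed.

Lemma entringer00 : entringer 0 0 = 1.
Proof.
rewrite -[0%N in X in entringer _ X]/(nat_of_ord (@ord0 0)) entringer_lift mul1r.
rewrite (bigD1 (1%g : 'S_0)) /=; last first.
  by apply/andP; split; apply/forallP=> -[].
rewrite big1 => [|s]; last first.
  by rewrite (_ : s = 1%g) ?eqxx ?andbF //; apply/permP=> -[].
by rewrite /inv_from big_ord0 addr0.
Qed.

Lemma entringerS0 n : entringer n.+1 0 = 0.
Proof.
rewrite -[0%N]/(nat_of_ord (@ord0 n.+1)) entringer_lift big_pred0 ?mulr0 // => s.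
by apply/negbTE/negP => /andP[_ /forallP/(_ ord0)].
Qed.

(** Raising the first entry from r to r + 1 gains a factor q and allows exactly one new second
    entry, r itself, which complementation turns into s. *)
Lemma entringerSS r s :
  entringer (r.+1 + s) r.+1
  = 'X * entringer (r + s.+1) r + 'X^(r.+1) * entringer (s + r) s.
Proof.
rewrite addnS (addnC s) addSn; set n := (r + s)%N.
have lt1 : (r.+1 < n.+2)%N by rewrite /n; lia.
have lt0 : (r < n.+2)%N by lia.
have := entringer_lift (Ordinal lt0); rewrite /= => ->.
have := entringer_lift (Ordinal lt1); rewrite /= => ->.
have first0 m (P : pred nat) (t : 'S_m.+1) :
  [forall i : 'I_m.+1, (i == 0 :> nat) ==> P (t i)] = P (t ord0).
  apply/forallP/idP => [/(_ ord0) // | Pt i]; apply/implyP => /eqP i0.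
  by rewrite (_ : i = ord0) //; apply: val_inj.
under eq_bigl => t do rewrite (first0 _ (fun v => (n.+1 - v.+1 < r.+1)%N)).
under [X in _ = 'X * (_ * X) + _]eq_bigl => t do
  rewrite (first0 _ (fun v => (n.+1 - v.+1 < r)%N)).
rewrite mulrA -exprS -mulrDr; congr (_ * _).
rewrite (bigID (fun t : 'S_n.+1 => n.+1 - (t ord0).+1 < r)%N) /=.
congr (_ + _); apply: eq_bigl => t; rewrite -andbA; congr (_ && _).
  by have := ltn_ord (t ord0); rewrite /n in t *; lia.
by have := ltn_ord (t ord0); rewrite /n in t *; lia.
Qed.

(** A maximal first entry puts no condition on the rest. *)
Lemma entringer_last n :
  entringer n n = 'X^n * \sum_(s in Alt_perms n) 'X^(alt_inv s).
Proof.
have := entringer_lift (@ord_max n); rewrite /= => ->; congr (_ * _).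
apply: eq_big => s; last by rewrite alt_invE.
have -> : s \in Alt_perms n = zigzag_from false s.
  rewrite inE; apply: eq_forallb => i; apply: eq_forallb => j.
  by rewrite addbF.
have -> : [forall i : 'I_n, (i == 0 :> nat) ==> (n - (s i).+1 < n)%N].
  by apply/forallP=> i; apply/implyP=> _; have := ltn_ord (s i); lia.
by rewrite andbT.
Qed.

(** * Comparison of the permutation sums with the pairings *)

(** In the recurrence, Phi(r, s+1) keeps the total and is reached by the inner induction on r;
    Phi(s, r) has a smaller total and is reached by the outer one. *)
Lemma entringer_pairing N r s : (r + s < N)%N ->
  entringer (r + s) r = 'X^((r + s).+1 ^ 2 %/ 4)
    * (if odd (r + s) then even_pairing N r s else odd_pairing N r s).
Proof.
have [n] := ubnP (r + s); elim: n r s => // n IHn r.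
elim: r => [|r IHr] s lt_n lt_N.
  case: s lt_n lt_N => [|s] _ lt_N.
    clear IHn; rewrite entringer00 /odd_pairing; case: N lt_N => [|N] _ //.
    rewrite big_ord_recl big1 /=; last by move=> i _; rewrite mulr0 ?mul0r.
    by rewrite !expr0 !mul1r addr0.
  (* Both pairings vanish: a segment of length 0 stays at height 0, and height 0 is absorbing for
     [tan_paths]. *)
  rewrite entringerS0 /even_pairing /odd_pairing !big1 ?if_same ?mulr0 //.
    by move=> [[|t] lt_t] _; rewrite /= ?qint0 ?(mulr0, mul0r).
  by move=> t _; rewrite /= mulr0 mul0r.
rewrite entringerSS IHr; [|lia..]; rewrite IHn; [|lia..].
rewrite addnS (addnC s r) addSn mulrCA (mulrCA 'X^(r.+1)) sqr_div4S.
case: (boolP (odd (r + s))) => odd_rs /=; rewrite ?odd_rs ?(negbTE odd_rs) /=.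
  rewrite odd_pairingS; last by lia.
  by rewrite exprD -!mulrA -odd_pairing_swap // !mulrDr; ring.
rewrite even_pairingS; last by lia.
by rewrite exprD -!mulrA -even_pairing_swap // !mulrDr; ring.
Qed.

(** For s = 0 the second segment is empty, so only the term t = 0 survives. *)
Lemma entringer_diag n :
  entringer n n = 'X^(n ^ 2 %/ 4 + n)
    * (if odd n then tan_paths n 1 else sec_paths n 0).
Proof.
rewrite -{1}(addn0 n) (@entringer_pairing n.+1) addn0 // /even_pairing /odd_pairing.
rewrite !big_ord_recl !big1 /=; try by move=> i _; rewrite mulr0.
rewrite !mulr1 !addr0 !subn0 sqr_div4S.
case: ifP => odd_n; rewrite mulrA -exprD; congr ('X^_ * _); lia.
Qed.

(** * Dyck paths as step-by-step recursions *)

Fixpoint dyck_from (y : nat) (s : seq bool) : bool :=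
  match s with
  | [::] => y == 0%N
  | true :: s' => dyck_from y.+1 s'
  | false :: s' => (0 < y)%N && dyck_from y.-1 s'
  end.

Fixpoint path_weight (g : bool -> nat -> {poly int}) (y : nat) (s : seq bool) :=
  match s with
  | [::] => 1
  | true :: s' => g true y.+1 * path_weight g y.+1 s'
  | false :: s' => g false y * path_weight g y.-1 s'
  end.

Lemma height0 s : height s 0 = 0.
Proof. by rewrite /height take0 big_nil. Qed.

Lemma height_cons b s k : height (b :: s) k.+1 = step_height b + height s k.
Proof. by rewrite /height /= big_cons. Qed.

(** Letting the starting height vary makes the condition on all prefixes a local one. *)
Lemma dyck_from_height y s :
  all (fun k => 0 <= y%:Z + height s k) (iota 0 (size s).+1)
    && (y%:Z + height s (size s) == 0) = dyck_from y s.
Proof.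
elim: s y => [|b s IHs] y.
  by rewrite /= height0 addr0; lia.
have all_iotaS (p : pred nat) m :
    all p (iota 0 m.+1) = p 0 && all (fun k => p k.+1) (iota 0 m).
  by rewrite /= -[1%N]/(1 + 0)%N iotaDl all_map.
rewrite [size (b :: s)]/= all_iotaS height0 addr0.
under eq_all => k do rewrite height_cons addrA.
rewrite height_cons addrA.
case: b; rewrite /step_height.
  have -> : y%:Z + 1 = y.+1%:Z by lia.
  by rewrite -andbA IHs.
case: y => [|y]; last first.
  have -> : y.+1%:Z + -1 = y%:Z by lia.
  by rewrite -andbA IHs.
(* A down-step from height 0 reaches -1, which falsifies the condition on prefixes. *)
by rewrite all_iotaS height0 addr0 !andbF.
Qed.

Lemma dyckE s : dyck s = dyck_from 0 s.
Proof.
rewrite -dyck_from_height /dyck add0r; congr (_ && _).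
by apply: eq_all => k; rewrite add0r.
Qed.

Lemma prod_level_from (g : bool -> nat -> {poly int}) y s : dyck_from y s ->
  \prod_(i < size s) g (nth false s i)
     `|Num.max (y%:Z + height s i)%R (y%:Z + height s i.+1)%R|%N
  = path_weight g y s.
Proof.
elim: s y => [|b s IHs] y ds; first by rewrite big_ord0.
rewrite big_ord_recl.
under eq_bigr => i _ do rewrite [nth _ _ _]/= !height_cons !addrA.
rewrite height_cons !height0 !addr0.
case: b ds; rewrite /step_height => ds.
  have -> : y%:Z + 1 = y.+1%:Z by lia.
  by rewrite IHs //=; congr (g true _ * _); lia.
case: y ds => // y ds.
have -> : y.+1%:Z + -1 = y%:Z by lia.
by rewrite IHs //=; congr (g false _ * _); lia.
Qed.

Lemma weight_evenE s : dyck s ->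
  weight_even s = path_weight (fun _ => qint) 0 s.
Proof.
rewrite dyckE => /prod_level_from <-.
by apply: eq_bigr => i _; rewrite !add0r.
Qed.

Lemma weight_oddE s : dyck s ->
  weight_odd s = path_weight (fun up l => qint (if up then l else l.+1)) 0 s.
Proof.
rewrite dyckE => /prod_level_from <-.
by apply: eq_bigr => i _; rewrite !add0r.
Qed.

Lemma sum_tupleS (V : nmodType) (T : finType) n (P : pred (seq T))
    (F : seq T -> V) :
  \sum_(D : n.+1.-tuple T | P D) F D
  = \sum_(b : T) \sum_(D : n.-tuple T | P (b :: D)) F (b :: D).
Proof.
rewrite pair_big_dep /=.
rewrite (reindex (fun p : T * n.-tuple T => [tuple of p.1 :: p.2])) //=.
exists (fun D : n.+1.-tuple T => (thead D, [tuple of behead D])) => [[b D] _ | D _] /=.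
  by congr pair; apply: val_inj.
by rewrite [RHS]tuple_eta; apply: val_inj.
Qed.

Lemma sum_tuple0 (V : nmodType) (T : finType) (P : pred (seq T))
    (F : seq T -> V) :
  \sum_(D : 0.-tuple T | P D) F D = if P [::] then F [::] else 0.
Proof.
rewrite big_mkcond (bigD1 [tuple]) //= big1 ?addr0 // => D.
by case/eqP; apply: tuple0.
Qed.

Lemma sum_dyck_from0 g y :
  \sum_(D : 0.-tuple bool | dyck_from y D) path_weight g y D = (y == 0%N)%:R.
Proof.
by rewrite (sum_tuple0 (dyck_from y) (path_weight g y)) /=; case: (y == 0%N).
Qed.

Lemma sum_dyck_fromS g n y :
  \sum_(D : n.+1.-tuple bool | dyck_from y D) path_weight g y D
  = g true y.+1
      * (\sum_(D : n.-tuple bool | dyck_from y.+1 D) path_weight g y.+1 D)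
  + (if y is y'.+1 then
       g false y * (\sum_(D : n.-tuple bool | dyck_from y' D) path_weight g y' D)
     else 0).
Proof.
rewrite (sum_tupleS n (dyck_from y) (path_weight g y)) big_bool /= !mulr_sumr.
congr (_ + _); case: y => [|y]; last by rewrite mulr_sumr.
by rewrite big_pred0.
Qed.

Lemma sum_weight_even n :
  \sum_(D : n.-tuple bool | dyck D) weight_even D = sec_paths n 0.
Proof.
rewrite (eq_bigr (fun D : n.-tuple bool => path_weight (fun _ => qint) 0 D)); last first.
  by move=> D /weight_evenE.
rewrite (eq_bigl _ _ (fun D => dyckE (tval D))).
elim: n 0%N => [|n IHn] y; first by rewrite sum_dyck_from0.
rewrite sum_dyck_fromS IHn /=; case: y => [|y]; last by rewrite IHn.
by rewrite qint0 mul0r.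
Qed.

(** Both steps leaving height y have odd weight [y+1], the factor of [tan_paths] at the shifted
    height y + 1. The additional last step, from 1 to 0, has weight 1. *)
Lemma sum_weight_odd n :
  \sum_(D : n.-tuple bool | dyck D) weight_odd D = tan_paths n.+1 1.
Proof.
pose g up l := qint (if up then l else l.+1).
rewrite (eq_bigr (fun D : n.-tuple bool => path_weight g 0 D)); last first.
  by move=> D /weight_oddE.
rewrite (eq_bigl _ _ (fun D => dyckE (tval D))).
rewrite -[1%N]/(0.+1); elim: n 0%N => [|n IHn] y.
  rewrite sum_dyck_from0 /= add0r; case: y => [|y]; last by rewrite mulr0.
  by rewrite qint1 mul1r.
rewrite sum_dyck_fromS IHn [tan_paths n.+2 _]/= mulrDr /g; congr (_ + _).
case: y => [|y]; last by rewrite IHn.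
(* A down-step here would enter the absorbing height with steps still to make. *)
by rewrite -[RHS]/(qint 1 * tan_paths n.+1 0) tan_pathsS0 mulr0.
Qed.

(** * Evaluation of [Ehat] and conclusion *)

Lemma sum_Alt_perms n :
  \sum_(s in Alt_perms n) 'X^(alt_inv s)
  = 'X^(n ^ 2 %/ 4) * (if odd n then tan_paths n 1 else sec_paths n 0).
Proof.
apply: (@mulfI _ ('X^n)); first by rewrite -size_poly_eq0 size_polyXn.
by rewrite -entringer_last entringer_diag addnC exprD mulrA.
Qed.

Lemma EhatE n :
  Ehat n = tofrac (if odd n then tan_paths n 1 else sec_paths n 0).
Proof.
rewrite /Ehat; under eq_bigr do rewrite -tofracXn.
rewrite -rmorph_sum sum_Alt_perms rmorphM rmorphXn mulKf //.
by rewrite expf_neq0 // tofrac_eq0 polyX_eq0.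
Qed.

Theorem theorem9p5 (m : nat) :
  tofrac (\sum_(D : (2 * m).-tuple bool | dyck D) weight_even D) = Ehat (2 * m) /\
  tofrac (\sum_(D : (2 * m).-tuple bool | dyck D) weight_odd D) = Ehat (2 * m).+1.
Proof.
by rewrite !EhatE sum_weight_even sum_weight_odd /= mul2n odd_double.
Qed.
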